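(* Assume that at least one of the following holds: (1) some component of $Y$ drifts to $-\infty$; (2) every component of $Y$ drifts to $+\infty$ and $\mathbb{P}(\tau=\infty)>0$; (3) there exists $\epsilon=(\epsilon_1,\dots,\epsilon_{d-1})$ with all $\epsilon_k>0$ such that $\mathbb{P}(Y_1>\epsilon)>0$. Then $h^{\uparrow}(x)<\infty$ for all $x\in\mathbb{W}$.
   Context: Let $d\ge2$ and let $X=(X^1,\dots,X^d)$ be a random walk on $\mathbb{R}^d$ (i.i.d. increments; the components may be dependent and have different distributions), started at $X_0=0$ under $\mathbb{P}$. $\mathbb{W}=\{x\in\mathbb{R}^d:x_1<\dots<x_d\}$. $Y=(Y^1,\dots,Y^{d-1})=(X^2-X^1,\dots,X^d-X^{d-1})$, $\overline{Y}^k_n=\max\{Y^k_j:0\le j\le n\}$, $\overline{Y}_n=(\overline{Y}^1_n,\dots,\overline{Y}^{d-1}_n)$. An inequality $a<b$ (or $a>b$) between vectors means strict inequality in every component. Standing assumption: for every $k$, $\mathbb{P}(Y^k_1>0)>0$ and $\mathbb{P}(Y^k_1<0)>0$. ''$Y^k$ drifts to $\pm\infty$'' means $Y^k_n\to\pm\infty$ almost surely. $\tau=\min\{n\ge1:X_n\notin\mathbb{W}\}$. With $J_1=\inf\{n>0:\overline{Y}^k_{n-1}<Y^k_n\text{ for all }k\in\{1,\dots,d-1\}\}$, for $x\in\mathbb{W}$ and $y=(x_2-x_1,\dots,x_d-x_{d-1})$ one sets $$h^{\uparrow}(x)=1+\mathbb{E}\Big(\sum_{n=1}^{J_1-1}\mathbf{1}\{\overline{Y}_{n-1}-Y_n<y\}\Big)\in[1,\infty].$$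 *)

(* Defs.v *)
From HB Require Import structures.
From mathcomp Require Import all_boot all_order all_algebra finmap.
From mathcomp Require Import all_classical all_reals all_analysis.

Set Implicit Arguments.
Unset Strict Implicit.
Unset Printing Implicit Defensive.

Import Order.TTheory GRing.Theory Num.Theory.
Import numFieldNormedType.Exports.

Local Open Scope classical_set_scope.
Local Open Scope ring_scope.

(* R^d is [d.-tuple R], whose sigma-algebra is generated by the coordinates;
   vectors of gaps, in R^(d-1), are functions ['I_d.-1 -> R]. *)

Definition vlt (R : realType) (m : nat) (a b : 'I_m -> R) : Prop :=
  forall k, a k < b k.

Definition weyl (R : realType) (d : nat) : set (d.-tuple R) :=
  [set x | sorted <%R (x : seq R)].
Arguments weyl R d : clear implicits.

(* With 0-based indices, gaps x = (x_1 - x_0, ..., x_(d-1) - x_(d-2)). *)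
Definition gaps (R : realType) (d : nat) (x : d.-tuple R) : 'I_d.-1 -> R :=
  fun k => x`_k.+1 - x`_k.

(* The least element of A, and +oo if A is empty. *)
Definition first_time (R : realType) (A : set nat) : \bar R :=
  ereal_inf [set n%:R%:E | n in A].
Arguments first_time R A : clear implicits.

Section IID.
Context {disp disp' : measure_display} {T : measurableType disp}
  {E : measurableType disp'} {R : realType}.
Variables (P : probability T R) (xi : nat -> {RV P >-> E}).

Definition independent_seq : Prop :=
  forall (J : {fset nat}) (A : nat -> set E),
    (forall n, n \in J -> measurable (A n)) ->
    P (\bigcap_(n in [set` J]) xi n @^-1` A n) =
    (\prod_(n <- J) P (xi n @^-1` A n))%E.

Definition identically_distributed : Prop :=
  forall n (A : set E), measurable A ->
    distribution P (xi n) A = distribution P (xi 0) A.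

Definition iid : Prop := independent_seq /\ identically_distributed.

End IID.

Section RandomWalk.
Context {disp : measure_display} {T : measurableType disp} {R : realType}.
Variables (P : probability T R) (d : nat) (xi : nat -> {RV P >-> d.-tuple R}).

(* The increment X_(n+1) - X_n is xi n. *)
Definition walk (n : nat) (w : T) : d.-tuple R :=
  [tuple \sum_(i < n) tnth (xi i w) k | k < d].

Definition gap_walk (n : nat) (w : T) : 'I_d.-1 -> R := gaps (walk n w).

Definition gap_max (n : nat) (w : T) : 'I_d.-1 -> R :=
  fun k => \big[Num.max/gap_walk 0 w k]_(j < n.+1) gap_walk j w k.

Definition drifts_pinfty (k : 'I_d.-1) : Prop :=
  {ae P, forall w, (fun n => gap_walk n w k) @ \oo --> +oo}.

Definition drifts_ninfty (k : 'I_d.-1) : Prop :=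
  {ae P, forall w, (fun n => gap_walk n w k) @ \oo --> -oo}.

Definition exit_time (w : T) : \bar R :=
  first_time R [set n | (1 <= n)%N /\ ~ weyl R d (walk n w)].

Definition first_record (w : T) : \bar R :=
  first_time R [set n | (0 < n)%N /\ vlt (gap_max n.-1 w) (gap_walk n w)].

(* The condition n < J_1 expresses n <= J_1 - 1 also when J_1 = +oo. *)
Definition h_up (x : d.-tuple R) : \bar R :=
  (1 + \int[P]_w \sum_(1 <= n <oo | (n%:R%:E < first_record w))
         (\1_[set v | vlt (gap_max n.-1 v - gap_walk n v)%R (gaps x)] w)%:E)%E.

End RandomWalk.

(* Main.v *)
Require Import Defs.
From HB Require Import structures.
From mathcomp Require Import all_boot all_order all_algebra finmap ring lra.
From mathcomp Require Import all_classical all_reals all_analysis.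
From mathcomp Require Import measurable_realfun.

Set Implicit Arguments.
Unset Strict Implicit.
Unset Printing Implicit Defensive.

Import Order.TTheory GRing.Theory Num.Theory.
Import numFieldNormedType.Exports.

Local Open Scope classical_set_scope.
Local Open Scope ring_scope.

(* Call n a record if every component of the walk exceeds its past at n, and a
   near-record if it does so up to the error y. If with positive probability
   all components of an increment are positive, they are even bounded below by
   some e > 0, and m further increments of this kind turn a near-record into a
   record, for a fixed m and with a fixed probability c > 0 independent of the
   past.

   In case (3), c P(n < J_1, n near-record) <= P(n < J_1 <= n + m), and the sum
   over n of the right-hand sides telescopes to at most m. Case (2) reduces to
   case (3), because tau = oo forces all components of Y_1 to be positive.

   In case (1), look only at the component that drifts to -oo. It suffices to
   bound the expected number of its records, and this number is finite because
   every record has the same positive probability of being the last one. *)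

(** * Product sets of trajectories and the sigma-algebras they generate *)

Section Rectangles.
Context {disp : measure_display} {E : measurableType disp}.
Implicit Types (U : nat -> set E) (n : nat).

Definition rectangle U : set (nat -> E) := [set s | forall i, U i (s i)].

(** Only the first [n] coordinates are constrained, so these sets form a pi-system generating the
    events that depend on the first [n] increments. *)
Definition rectangles n : set (set (nat -> E)) :=
  [set A | exists U, [/\ forall i, measurable (U i),
     forall i, (n <= i)%N -> U i = setT & A = rectangle U]].

Definition all_rectangles : set (set (nat -> E)) := \bigcup_n rectangles n.

Lemma rectangles_le m n : (m <= n)%N -> rectangles m `<=` rectangles n.
Proof.
move=> mn _ [U [mU UT ->]]; exists U; split => // i ni.
exact/UT/(leq_trans mn).
Qed.

Lemma rectangles_setI n : setI_closed (rectangles n).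
Proof.
move=> _ _ [U [mU UT ->]] [V [mV VT ->]]; exists (fun i => U i `&` V i); split.
- by move=> i; exact: measurableI.
- by move=> i ni; rewrite UT// VT// setIT.
- apply/seteqP; split => [s [Us Vs] i|s UVs]; first by split.
  by split => i; case: (UVs i).
Qed.

Lemma rectangles_setT n : rectangles n setT.
Proof.
exists (fun=> setT); split => //.
by apply/seteqP; split.
Qed.

Lemma all_rectangles_setI : setI_closed all_rectangles.
Proof.
move=> A B [m _ mA] [n _ nB]; exists (maxn m n) => //.
apply: rectangles_setI.
  exact: rectangles_le (leq_maxl _ _) _ mA.
exact: rectangles_le (leq_maxr _ _) _ nB.
Qed.

Lemma all_rectangles_setT : all_rectangles setT.
Proof. by exists 0%N => //; exact: rectangles_setT. Qed.

(** The same paths carry several sigma-algebras. Giving each its own type lets the closure rules for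
    measurable functions apply to functionals of the path. *)
Definition past n := g_sigma_algebraType (rectangles n).
Definition trajectories := g_sigma_algebraType all_rectangles.

Lemma rectangles_coord n i (A : set E) : (i < n)%N -> measurable A ->
  rectangles n ((fun s => s i) @^-1` A).
Proof.
move=> ltin mA; exists (fun j => if j == i then A else setT); split.
- by move=> j; case: ifP.
- by move=> j nj; rewrite gtn_eqF// (leq_trans ltin).
- apply/seteqP; split => [s As j|s /(_ i)]; last by rewrite eqxx.
  by case: eqP => [->|].
Qed.

Lemma measurable_past_coord n i : (i < n)%N ->
  measurable_fun setT (fun s : past n => (s i : E)).
Proof.
move=> ltin _ A mA; rewrite setTI.
by apply: sub_sigma_algebra; exact: rectangles_coord.
Qed.

Lemma measurable_trajectories_coord i :
  measurable_fun setT (fun s : trajectories => (s i : E)).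
Proof.
move=> _ A mA; rewrite setTI; apply: sub_sigma_algebra; exists i.+1 => //.
exact: rectangles_coord.
Qed.

End Rectangles.

(** * Extension of a product rule from a pi-system *)

Section PiLambda.
Context {disp : measure_display} {T : measurableType disp} {R : realType}.
Variables (P : probability T R) (S : Type) (X Y : T -> S).
Variables (G : set (set S)) (C : set T).
Hypotheses (GI : setI_closed G) (mC : measurable C).
Hypotheses (mX : forall A, G A -> measurable (X @^-1` A))
  (mY : forall A, G A -> measurable (Y @^-1` A)).

(** The sets obeying the rule form a Dynkin system: complements by subtraction, disjoint unions by
    countable additivity. Measurability of preimages is given on [G] only, so it is carried along.
    [Y] may be [X] itself, or a copy of [X] with the same law. *)
Lemma product_rule_pi_lambda :
  (forall A, G A -> P (X @^-1` A `&` C) = P (Y @^-1` A) * P C)%E ->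
  forall A, <<s G >> A ->
    [/\ measurable (X @^-1` A), measurable (Y @^-1` A) &
        P (X @^-1` A `&` C) = (P (Y @^-1` A) * P C)%E].
Proof.
move=> GP; rewrite -setI_closed_g_dynkin_g_sigma_algebra//.
apply: smallest_sub; last by move=> A GA; split; auto.
split.
- by split; rewrite ?preimage_setT// setTI probability_setT mul1e.
- move=> A [mXA mYA XYA].
  have finP B : measurable B -> P B \is a fin_num by exact: fin_num_measure.
  split.
  + exact: (measurableC mXA).
  + exact: (measurableC mYA).
  + rewrite [_ `&` C](_ : _ = C `\` X @^-1` A); last by rewrite setDE setIC.
    rewrite measureD//; last by rewrite ltey_eq finP.
    rewrite [X in (_ - P X)%E]setIC XYA.
    have -> : Y @^-1` (~` A) = ~` (Y @^-1` A) by [].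
    rewrite probability_setC// muleBl ?mul1e ?finP//.
- move=> F tF DF.
  have mXF i : measurable (X @^-1` F i) by case: (DF i).
  have mYF i : measurable (Y @^-1` F i) by case: (DF i).
  rewrite !preimage_bigcup; split.
  - by apply: bigcup_measurable => i _; exact: mXF.
  - by apply: bigcup_measurable => i _; exact: mYF.
  have tpre (Z : T -> S) : trivIset setT (fun i => Z @^-1` F i).
    move=> i j _ _ [w [Fi Fj]]; apply: tF => //; exists (Z w); by split.
  rewrite setI_bigcupl measure_bigcup//.
  + rewrite measure_bigcup//.
    rewrite muleC -(fineK (fin_num_measure P C mC)) -nneseriesZl//.
    apply: eq_eseriesr => i _; case: (DF i) => _ _ PF.
    by rewrite fineK ?fin_num_measure// muleC.
  + by move=> i _; exact: measurableI.
  + exact: (trivIset_setIr (tpre X)).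
Qed.

End PiLambda.

(** * Independence of the past and stationarity of the shifted trajectory *)

Definition after (E : Type) (n : nat) (s : nat -> E) : nat -> E :=
  fun i => s (n + i)%N.

Section MarkovShift.
Context {disp disp' : measure_display} {T : measurableType disp}
  {E : measurableType disp'} {R : realType}.
Variables (P : probability T R) (xi : nat -> {RV P >-> E}).
Hypothesis xi_iid : iid xi.

Definition trajectory (w : T) : nat -> E := fun i => xi i w.

Lemma measurable_trajectory_rectangle n (U : nat -> set E) :
  (forall i, measurable (U i)) ->
  measurable ((after n \o trajectory) @^-1` rectangle U).
Proof.
move=> mU; rewrite (_ : _ @^-1` _ = \bigcap_i (xi (n + i)%N @^-1` U i)).
  by apply: bigcapT_measurable => i; exact: measurable_funPTI.
by apply/seteqP; split => [w Uw i _|w Uw i]; [exact: Uw|exact: (Uw i)].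
Qed.

Lemma prob_rectangle n (U : nat -> set E) :
  (forall i, measurable (U i)) -> (forall i, (n <= i)%N -> U i = setT) ->
  P (trajectory @^-1` rectangle U) =
  (\prod_(0 <= i < n) P (xi i @^-1` U i))%E.
Proof.
move=> mU UT; have [ind _] := xi_iid.
have := ind [fset i in iota 0 n]%fset U (fun i _ => mU i).
rewrite (perm_big (iota 0 n)) /=; last first.
  apply: uniq_perm; [exact: fset_uniq|exact: iota_uniq|].
  by move=> i; rewrite in_fset.
rewrite /index_iota subn0 => <-; congr (P _).
apply/seteqP; split => [w Uw i _|w Uw i]; first exact: Uw.
have [ni|ltin] := leqP n i; first by rewrite UT.
by apply: Uw => /=; rewrite in_fset/= mem_iota.
Qed.

Lemma prob_same (i j : nat) (A : set E) : measurable A ->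
  P (xi i @^-1` A) = P (xi j @^-1` A).
Proof.
move=> mA; have [_ same] := xi_iid.
exact: etrans (same i A mA) (esym (same j A mA)).
Qed.

(** The intersection is again a rectangle, with sides [U] before [n] and [V] moved by [n] from there
    on. Its product formula splits at [n], and identical distribution moves the second factor back
    to time 0. *)
Lemma prob_rectangle_shift m n (U V : nat -> set E) :
  (forall i, measurable (U i)) -> (forall i, (n <= i)%N -> U i = setT) ->
  (forall i, measurable (V i)) -> (forall i, (m <= i)%N -> V i = setT) ->
  P (trajectory @^-1` rectangle U `&`
     (after n \o trajectory) @^-1` rectangle V) =
  (P (trajectory @^-1` rectangle U) * P (trajectory @^-1` rectangle V))%E.
Proof.
move=> mU UT mV VT.
pose W i := if (i < n)%N then U i else V (i - n)%N.
have mW i : measurable (W i) by rewrite /W; case: ifP.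
have WT i : (n + m <= i)%N -> W i = setT.
  move=> nmi; rewrite /W ltnNge (leq_trans _ nmi) ?leq_addr//=.
  by rewrite VT// leq_subRL// (leq_trans _ nmi) ?leq_addr.
have -> : trajectory @^-1` rectangle U `&`
     (after n \o trajectory) @^-1` rectangle V = trajectory @^-1` rectangle W.
  apply/seteqP; split => [w [Uw Vw] i|w Ww]; rewrite /W.
    case: ltnP => [_|ni]; first exact: Uw.
    by have := Vw (i - n)%N; rewrite /= /after subnKC.
  split => i; last first.
    by have := Ww (n + i)%N; rewrite /W ltnNge leq_addr/= addKn.
  have := Ww i; rewrite /W; case: ltnP => // ni _.
  by rewrite UT.
rewrite (prob_rectangle mW WT) (prob_rectangle mU UT) (prob_rectangle mV VT).
rewrite (@big_cat_nat _ _ _ n)/= ?leq_addr//; congr (_ * _)%E.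
  by apply: eq_big_nat => i /andP[_ ltin]; rewrite /W ltin.
rewrite -[X in index_iota X]add0n big_addn addKn.
apply: eq_big_nat => i _; rewrite /W ltnNge leq_addl/= addnK.
exact: prob_same.
Qed.

(** The rule holds for rectangles; two pi-lambda arguments extend it, first in [A] and then in
    [B]. *)
Lemma markov_shift n (A B : set (nat -> E)) :
  <<s rectangles n >> A -> <<s all_rectangles >> B ->
  [/\ measurable (trajectory @^-1` A),
      measurable ((after n \o trajectory) @^-1` B) &
      P (trajectory @^-1` A `&` (after n \o trajectory) @^-1` B) =
      (P (trajectory @^-1` A) * P (trajectory @^-1` B))%E].
Proof.
have mrect k D : rectangles k D -> forall l,
    measurable ((after l \o trajectory) @^-1` D).
  by move=> [U [mU _ ->]] l; exact: measurable_trajectory_rectangle.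
have marect D : all_rectangles D -> forall l,
    measurable ((after l \o trajectory) @^-1` D).
  by move=> [k _ /mrect].
move=> hA.
(* First pass: the future event is a fixed rectangle and the past event varies. *)
have pastA D : all_rectangles D ->
    [/\ measurable (trajectory @^-1` A), measurable (trajectory @^-1` A) &
     P (trajectory @^-1` A `&` (after n \o trajectory) @^-1` D) =
     (P (trajectory @^-1` A) * P ((after n \o trajectory) @^-1` D))%E].
  move=> arD; move: A hA; apply: product_rule_pi_lambda.
  - exact: rectangles_setI.
  - exact: marect.
  - by move=> F /mrect/(_ 0%N).
  - by move=> F /mrect/(_ 0%N).
  - case: arD => m _ [V [mV VT ->]] F [U [mU UT ->]].
    rewrite (prob_rectangle_shift mU UT mV VT); congr (_ * _)%E.
    (* With the whole space as past event, the rule says that the shift preserves the probability of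
       a rectangle. *)
    have := @prob_rectangle_shift m n (fun=> setT) V.
    rewrite [X in trajectory @^-1` X](_ : _ = setT); last exact/seteqP.
    by rewrite preimage_setT setTI probability_setT mul1e => ->.
have [mA _ _] := pastA _ all_rectangles_setT.
move=> hB; rewrite setIC muleC.
suff [] : [/\ measurable ((after n \o trajectory) @^-1` B),
  measurable (trajectory @^-1` B) &
  P ((after n \o trajectory) @^-1` B `&` trajectory @^-1` A) =
    (P (trajectory @^-1` B) * P (trajectory @^-1` A))%E] by [].
(* Second pass: the past event is fixed, and the unshifted trajectory in the role of [Y] removes the
   shift. *)
move: B hB; apply: product_rule_pi_lambda => //.
- exact: all_rectangles_setI.
- by move=> F /marect/(_ n).
- by move=> F /marect/(_ 0%N).
- move=> D arD; have [_ _ AD] := pastA _ arD.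
  rewrite setIC AD muleC; congr (_ * _)%E.
  case: arD => m _ [V [mV VT ->]].
  have := @prob_rectangle_shift m n (fun=> setT) V.
  rewrite [X in trajectory @^-1` X](_ : _ = setT); last exact/seteqP.
  by rewrite preimage_setT setTI probability_setT mul1e => ->.
Qed.

End MarkovShift.

(** * Auxiliary facts on series, sequences and measurability *)

Lemma nneseries_le_bound (R : realType) (u : nat -> \bar R) (M : \bar R) :
  (forall n, 0 <= u n)%E -> (forall N, \sum_(0 <= n < N) u n <= M)%E ->
  (\sum_(0 <= n <oo) u n <= M)%E.
Proof.
move=> u0 uM; apply: lime_le; first exact: is_cvg_nneseries.
by apply: nearW => N; exact: uM.
Qed.

(** The subtracted terms are those with indices from [m] to [N + m - 1]; they cancel all but at most
    the first [m] terms, each at most 1. *)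
Lemma sum_telescope_lag_le (R : realType) (a : nat -> R) (m N : nat) :
  (forall n, 0 <= a n <= 1) ->
  \sum_(0 <= n < N) (a n - a (n + m)%N) <= m%:R.
Proof.
move=> a01; have a0 n : 0 <= a n by case/andP: (a01 n).
rewrite sumrB lerBlDr.
have -> : \sum_(0 <= n < N) a (n + m)%N = \sum_(m <= n < N + m) a n.
  by rewrite -[in RHS](add0n m) big_addn addnK.
apply: (@le_trans _ _ (\sum_(0 <= n < N + m) a n)).
  by rewrite (@big_cat_nat _ _ _ N _ (N + m))/= ?leq_addr// lerDl sumr_ge0.
rewrite (@big_cat_nat _ _ _ m)/= ?leq_addl// lerD2r.
apply: (@le_trans _ _ (\sum_(0 <= n < m) 1)).
  by apply: ler_sum => n _; case/andP: (a01 n).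
by rewrite big_const_nat subn0 iter_addr addr0.
Qed.

(** Beyond some [N] the sequence stays below [u 0], so a maximum over the indices up to [N] is
    global. Its least index gives strictness before it. *)
Lemma ninfty_attains_max (R : realType) (u : nat -> R) :
  u n @[n --> \oo] --> -oo ->
  exists n, (forall j, (j < n)%N -> u j < u n) /\ forall j, u (n + j)%N <= u n.
Proof.
move=> /cvgrNyPle/(_ (u 0%N))[N _ uN].
pose p n := [forall j : 'I_N.+1, u j <= u n].
have [n pn] : exists n, p n.
  have [i _ imax] := @arg_maxP _ R _ (@ord0 N) predT (fun i => u i) isT.
  by exists i; apply/forallP => j; exact: imax.
have exp : exists n, p n by exists n.
case: (ex_minnP exp) => {pn}n /forallP pn nmin; exists n.
have un j : u j <= u n.
  have [jN|Nj] := ltnP j N.+1; first exact: (pn (Ordinal jN)).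
  by rewrite (le_trans (uN j (ltnW Nj)))//; exact: (pn ord0).
split=> [j jn|j]; last exact: un.
rewrite ltNge; apply/negP => unj.
suff /nmin : p j by rewrite leqNgt jn.
by apply/forallP => i; rewrite (le_trans (un i)).
Qed.

Lemma measurable_all_gt (disp : measure_display) (T : measurableType disp)
    (R : realType) (K : finType) (f : K -> T -> R) (e : K -> R) :
  (forall k, measurable_fun setT (f k)) ->
  measurable [set x | forall k, e k < f k x].
Proof.
move=> mf; rewrite (_ : [set _ | _] = \bigcap_k (f k @^-1` `]e k, +oo[)).
  apply: fin_bigcap_measurable => // k _.
  by rewrite -[X in measurable X]setTI; exact: (mf k).
apply/seteqP; split => x /=.
  by move=> ex k _; rewrite /= in_itv/= andbT; exact: ex.
by move=> ex k; have := ex k I; rewrite /= in_itv/= andbT.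
Qed.

(** * Partial sums and record events *)

Section Walk.
Context {disp : measure_display} {E : measurableType disp} {R : realType}.

Definition psum (g : E -> R) (n : nat) (s : nat -> E) : R :=
  \sum_(i < n) g (s i).

Lemma psumD (g : E -> R) m n s :
  psum g (m + n)%N s = psum g m s + psum g n (after m s).
Proof. by rewrite /psum big_split_ord. Qed.

Lemma measurable_past_psum (g : E -> R) n j : measurable_fun setT g ->
  (j <= n)%N -> measurable_fun setT (fun s : past n => psum g j s).
Proof.
move=> mg jn; apply: measurable_sum => i.
apply: (measurableT_comp mg); apply: measurable_past_coord.
exact: leq_trans (ltn_ord i) jn.
Qed.

Lemma measurable_trajectories_psum (g : E -> R) j : measurable_fun setT g ->
  measurable_fun setT (fun s : trajectories => psum g j s).
Proof.
move=> mg; apply: measurable_sum => i.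
exact: (measurableT_comp mg (measurable_trajectories_coord _)).
Qed.

Definition nonpositive (g : E -> R) : set (nat -> E) :=
  [set s | forall j, psum g j s <= 0].

Lemma nonpositive_trajectories (g : E -> R) : measurable_fun setT g ->
  <<s all_rectangles >> (nonpositive g).
Proof.
move=> mg; suff : measurable (nonpositive g : set trajectories) by [].
rewrite (_ : nonpositive g =
  \bigcap_j ((fun s : trajectories => psum g j s) @^-1` `]-oo, 0])).
  apply: bigcapT_measurable => j; rewrite -[X in measurable X]setTI.
  exact: (measurable_trajectories_psum j mg).
apply/seteqP; split => s.
  by move=> sle0 j _ /=; rewrite in_itv/=; exact: sle0.
by move=> sle0 j; have := sle0 j I; rewrite /= in_itv.
Qed.

Context {K : finType}.
Variable f : K -> E -> R.

(** At [n = 0] the condition is vacuous, so time 0 counts as a record; hence [no_record] starts at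
    1. The index type [K] is either the set of all gaps or [unit], for a single gap. *)
Definition near_record (y : K -> R) (n : nat) : set (nat -> E) :=
  [set s | forall k j, (j < n)%N -> psum (f k) j s - psum (f k) n s < y k].

Definition record := near_record (fun=> 0).

Definition no_record (n : nat) : set (nat -> E) :=
  [set s | forall j, (0 < j <= n)%N -> ~ record j s].

Hypothesis mf : forall k, measurable_fun setT (f k).

Lemma near_record_past y n m : (n <= m)%N ->
  <<s rectangles m >> (near_record y n).
Proof.
move=> nm; suff : measurable (near_record y n : set (past m)) by [].
rewrite (_ : near_record y n = \bigcap_k \bigcap_(j in `I_n)
   ((fun s : past m => psum (f k) j s - psum (f k) n s) @^-1` `]-oo, y k[)).
  apply: fin_bigcap_measurable => // k _.
  apply: fin_bigcap_measurable => // j /= jn.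
  have mB : measurable_fun setT
      (fun s : past m => psum (f k) j s - psum (f k) n s).
    apply: measurable_funB; apply: measurable_past_psum => //.
    exact: leq_trans (ltnW jn) nm.
  by rewrite -[X in measurable X]setTI; exact: mB.
apply/seteqP; split => s.
  by move=> ys k _ j jn /=; rewrite in_itv/=; exact: ys.
by move=> ys k j jn; have := ys k I j jn; rewrite /= in_itv.
Qed.

Lemma no_record_past n : <<s rectangles n >> (no_record n).
Proof.
suff : measurable (no_record n : set (past n)) by [].
rewrite (_ : no_record n =
  \bigcap_(j in [set j | (0 < j <= n)%N]) ~` (record j : set (past n))).
  apply: bigcap_measurableType => j /andP[_ jn].
  apply: measurableC; exact: near_record_past.
by apply/seteqP; split.
Qed.

End Walk.

Arguments no_record_past {disp E R K f} mf n.

(** * From near-records to records *)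

Section NearRecords.
Context {disp disp' : measure_display} {T : measurableType disp}
  {E : measurableType disp'} {R : realType}.
Variables (P : probability T R) (xi : nat -> {RV P >-> E}).
Hypothesis xi_iid : iid xi.

Local Notation X := (trajectory xi).

Lemma measurable_past_event n (A : set (nat -> E)) :
  <<s rectangles n >> A -> measurable (X @^-1` A).
Proof.
move=> nA; have [] // := markov_shift xi_iid nA (B := setT).
by apply: sub_sigma_algebra; exact: all_rectangles_setT.
Qed.

Section Jump.
Context {K : finType}.
Variable f : K -> E -> R.
Hypothesis mf : forall k, measurable_fun setT (f k).
Hypothesis f_pos : (0 < P [set w | forall k, (0 < f k (xi 0 w))%R])%E.

Let above e : set E := [set x | forall k, e < f k x].

Let measurable_above e : measurable (above e).
Proof. exact: measurable_all_gt. Qed.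

(** Since [K] is finite, the event that all components are positive is covered by the countably many
    events with threshold [1/(n+1)], which cannot all be null. *)
Lemma uniformly_positive_increment :
  exists2 e : R, 0 < e & (0 < P (xi 0 @^-1` above e))%E.
Proof.
apply: contrapT => noe.
have null (n : nat) : P (xi 0 @^-1` above n.+1%:R^-1) = 0%E.
  apply/eqP; rewrite eq_le measure_ge0 andbT leNgt; apply/negP => e0.
  by apply: noe; exists n.+1%:R^-1.
suff : P [set w | forall k, (0 < f k (xi 0 w))%R] = 0%E.
  by move=> P0; move: f_pos; rewrite P0 ltxx.
apply: measure_negligible.
  by rewrite -[[set _ | _]]/(xi 0 @^-1` above 0); exact: measurable_funPTI.
have : P.-negligible (\bigcup_n (xi 0 @^-1` above n.+1%:R^-1)).
  apply: negligible_bigcup => n; apply/negligibleP; last exact: null.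
  exact: measurable_funPTI.
apply: negligibleS => w w0.
pose m := \max_k Num.bound ((f k (xi 0 w))^-1).
exists m => // k; rewrite invf_plt ?posrE ?ltr0n ?(w0 k)//.
have := archi_boundP (ltW (_ : 0 < (f k (xi 0 w))^-1)).
rewrite invr_gt0 => /(_ (w0 k))/lt_le_trans; apply; rewrite ler_nat.
by rewrite leqW// (leq_bigmax (F := fun k => Num.bound (f k (xi 0 w))^-1) k).
Qed.

(* A near-record turns into a record if all components of the next few
   increments are bounded away from 0. *)
Lemma near_record_to_record (y : K -> R) : exists m (c : R),
  [/\ (0 < m)%N, 0 < c & forall n (A : set (nat -> E)), <<s rectangles n >> A ->
    (c%:E * P (X @^-1` (A `&` near_record f y n)) <=
     P (X @^-1` (A `&` record f (n + m)%N)))%E].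
Proof.
have [e e0 Pe] := uniformly_positive_increment.
(* Large enough that [m] increments above [e] make up for the error [y] in every component. *)
pose m := (\max_k Num.bound `|y k / e|).+1.
have my k : y k <= m%:R * e.
  rewrite -ler_pdivrMr//; have := ler_norm (y k / e) => /le_trans; apply.
  have := archi_boundP (normr_ge0 (y k / e)) => /ltW/le_trans; apply.
  rewrite ler_nat leqW//.
  exact: (leq_bigmax (F := fun k => Num.bound `|y k / e|) k).
pose U i := if (i < m)%N then above e else setT.
have mU i : measurable (U i) by rewrite /U; case: ifP.
have UT i : (m <= i)%N -> U i = setT by rewrite /U leqNgt; case: ifP.
pose J := rectangle U.
have PJ : (0 < P (X @^-1` J))%E.
  rewrite (prob_rectangle xi_iid mU UT) big_seq.
  apply: (big_ind (fun x => 0 < x)%E) => //.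
    by move=> a b a0 b0; exact: mule_gt0.
  move=> i; rewrite mem_index_iota => /andP[_ im].
  by rewrite /U im (prob_same xi_iid i 0%N).
have JA : <<s all_rectangles >> J.
  by apply: sub_sigma_algebra; exists m => //; exists U.
have psum_ge k l j s : J s -> (l + j <= m)%N ->
    j%:R * e <= psum (f k) j (after l s).
  move=> Js ljm; apply: (@le_trans _ _ (\sum_(i < j) e)).
    by rewrite sumr_const card_ord mulr_natl.
  apply: ler_sum => i _; have := Js (l + i)%N; rewrite /U.
  by rewrite (leq_trans _ ljm) ?ltn_add2l// => /(_ k)/ltW.
have PJfin : P (X @^-1` J) \is a fin_num.
  apply: fin_num_measure; rewrite -[X]/(after 0 \o X).
  exact: measurable_trajectory_rectangle.
exists m, (fine (P (X @^-1` J))); split => //.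
  by rewrite fine_gt0// PJ ltey_eq PJfin.
move=> n A nA.
have nAy : <<s rectangles n >> (A `&` near_record f y n).
  have := near_record_past mf y (leqnn n).
  exact: (@measurableI _ (past n)).
have [mAy mJ AyJ] := markov_shift xi_iid nAy JA.
rewrite fineK// muleC -AyJ; apply: le_measure; rewrite ?inE.
- exact: measurableI.
- apply: (@measurable_past_event (n + m)).
  apply: (@measurableI _ (past (n + m))); last exact: near_record_past.
  apply: (sub_sigma_algebra2 _ nA).
  by apply: rectangles_le; rewrite leq_addr.
move=> w [[Aw yw] Jw]; split=> // k j; rewrite psumD.
(* For a time before [n], the gain of at least [m * e] over the [m] new steps covers the deficit,
   which is below [y k]. *)
have [jn _|nj jnm] := ltnP j n.
  have := psum_ge k 0%N m _ Jw (leqnn m).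
  by have := yw k j jn; have := my k; rewrite -[after 0 _]/(after n (X w)); lra.
pose l := (j - n)%N.
(* For a time among the new steps, at least one step remains, and all remaining steps go up. *)
have lm : (l < m)%N by rewrite ltn_subLR.
have -> : j = (n + l)%N by rewrite subnKC.
rewrite psumD -(subnKC (ltnW lm)) psumD.
have := psum_ge k l (m - l)%N _ Jw.
rewrite (subnKC (ltnW lm)) => /(_ (leqnn m)).
have : 0 < (m - l)%:R * e by rewrite mulr_gt0// ltr0n subn_gt0.
lra.
Qed.

End Jump.
End NearRecords.

(** * Summability of near-record probabilities *)

Section RecordSums.
Context {disp disp' : measure_display} {T : measurableType disp}
  {E : measurableType disp'} {R : realType}.
Variables (P : probability T R) (xi : nat -> {RV P >-> E}).
Hypothesis xi_iid : iid xi.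

Local Notation X := (trajectory xi).

(** With [A := no_record f n], the jump to a record forces the first record into the times [n + 1]
    to [n + m]. This has probability [a n - a (n + m)], so the series is at most [m / c]. *)
Lemma sum_near_record_before_record_lty (K : finType) (f : K -> E -> R)
    (y : K -> R) :
  (forall k, measurable_fun setT (f k)) ->
  (0 < P [set w | forall k, (0 < f k (xi 0 w))%R])%E ->
  (\sum_(0 <= n <oo) P (X @^-1` (no_record f n `&` near_record f y n)) < +oo)%E.
Proof.
move=> mf f_pos.
have [m [c [m0 c0 jump]]] := near_record_to_record xi_iid mf f_pos y.
pose a n := fine (P (X @^-1` no_record f n)).
have mno n : measurable (X @^-1` no_record f n).
  exact: (measurable_past_event xi_iid (no_record_past mf n)).
have aE n : P (X @^-1` no_record f n) = (a n)%:E.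
  by rewrite fineK// fin_num_measure.
have a01 n : 0 <= a n <= 1.
  by rewrite -!lee_fin -aE measure_ge0/= probability_le1.
apply: (@le_lt_trans _ _ ((m%:R / c)%:E)); last exact: ltry.
apply: nneseries_le_bound => [n|N]; first exact: measure_ge0.
rewrite EFinM muleC -lee_pdivrMl ?invr_gt0// invrK ge0_sume_distrr; last first.
  by move=> n _; exact: measure_ge0.
apply: (@le_trans _ _ (\sum_(0 <= n < N) (a n - a (n + m)%N)%:E)%E); last first.
  by rewrite sumEFin lee_fin; exact: sum_telescope_lag_le.
apply: lee_sum => n _; apply: (le_trans (jump n _ (no_record_past mf n))).
have sub : no_record f (n + m) `<=` no_record f n.
  move=> s sno j /andP[j0 jn]; apply: sno.
  by rewrite j0 (leq_trans jn)// leq_addr.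
have <- : P (X @^-1` no_record f n `\` X @^-1` no_record f (n + m)%N) =
    (a n - a (n + m)%N)%:E.
  rewrite measureD//; last by rewrite ltey_eq fin_num_measure.
  rewrite setIidr; last by move=> w; exact: sub.
  by rewrite EFinB -!aE.
apply: le_measure; rewrite ?inE.
- apply: (@measurable_past_event _ _ _ _ _ _ _ xi_iid (n + m)%N).
  apply: (@measurableI _ (past (n + m)%N)); last exact: near_record_past.
  apply: (sub_sigma_algebra2 _ (no_record_past mf n)).
  by apply: rectangles_le; rewrite leq_addr.
- exact: measurableD.
- move=> w [nno rec]; split=> // /(_ (n + m)%N); apply => //.
  by rewrite leqnn addn_gt0 m0 orbT.
Qed.

(* The time of the first maximum of a walk with drift to -oo is the last
   record. The walk after n is independent of n being a record, so 1 is the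
   probability of never exceeding 0 times the expected number of records. *)
Lemma sum_record_lty (g : E -> R) : measurable_fun setT g ->
  {ae P, forall w, psum g n (X w) @[n --> \oo] --> -oo} ->
  (\sum_(0 <= n <oo) P (X @^-1` record (fun _ : unit => g) n) < +oo)%E.
Proof.
move=> mg gdrift; pose rec := record (fun _ : unit => g).
have mrec n : <<s rectangles n >> (rec n) by exact: near_record_past.
have shift_rec n := markov_shift xi_iid (mrec n) (nonpositive_trajectories mg).
(* The event that [n] is the last record; these events are disjoint and, by the drift, cover almost
   every path. *)
pose L n := X @^-1` rec n `&` (after n \o X) @^-1` nonpositive g.
have mL n : measurable (L n).
  by have [? ? _] := shift_rec n; exact: measurableI.
pose p := fine (P (X @^-1` nonpositive g)).
have PL n : P (L n) = (p%:E * P (X @^-1` rec n))%E.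
  have [_ _ LE] := shift_rec n.
  have [_ mB _] := shift_rec 0%N.
  by rewrite /L LE muleC fineK// fin_num_measure.
have tL : trivIset setT L.
  have LL n j w : (n < j)%N -> L n w -> L j w -> False.
    move=> nj [_ Bn] [recj _].
    have := Bn (j - n)%N; have := recj tt n nj.
    by rewrite -{1}(subnKC (ltnW nj)) psumD /=; lra.
  move=> i j _ _ [w [Li Lj]].
  by have [ij|ji|//] := ltngtP i j; [case: (LL i j w)|case: (LL j i w)].
have PU : P (\bigcup_n L n) = 1%E.
  have mU : measurable (\bigcup_n L n) by exact: bigcupT_measurable.
  rewrite -[X in P X]setCK probability_setC; last exact: measurableC.
  suff -> : P (~` (\bigcup_n L n)) = 0%E by rewrite sube0.
  apply: measure_negligible; first exact: measurableC.
  apply: negligibleS gdrift => w nLw wdrift; apply: nLw.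
  have [n [nrec nmax]] := ninfty_attains_max wdrift.
  exists n => //; split => [k j jn|j] /=.
    by rewrite subr_lt0; exact: nrec.
  by have := nmax j; rewrite psumD; lra.
have : (p%:E * \sum_(0 <= n <oo) P (X @^-1` rec n) = 1)%E.
  rewrite -nneseriesZl//.
  rewrite -PU measure_semi_bigcup//; last exact: bigcupT_measurable.
  by apply: eq_eseriesr => n _; exact/esym/PL.
(* The product of [p] and the series is 1, which excludes [p = 0]; for [p > 0] an infinite series
   would make the product infinite. *)
case: (ltgtP p 0) => [p0|p0|->].
- have : (0 <= p)%R by rewrite fine_ge0.
  by rewrite leNgt p0.
- rewrite ltey; apply: contra_eqN => /eqP ->.
  by rewrite gt0_muley ?lte_fin.
- by rewrite mul0e => /eqP; rewrite eq_sym onee_eq0.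
Qed.

(** The jump estimate with [A := setT] bounds [c] times each term by the probability of a record [m]
    steps later, so the series of record probabilities dominates. *)
Lemma sum_near_record_lty (g : E -> R) (y : R) : measurable_fun setT g ->
  (0 < P [set w | (0 < g (xi 0 w))%R])%E ->
  {ae P, forall w, psum g n (X w) @[n --> \oo] --> -oo} ->
  (\sum_(0 <= n <oo)
     P (X @^-1` near_record (fun _ : unit => g) (fun=> y) n) < +oo)%E.
Proof.
move=> mg g_pos /(sum_record_lty mg) sum_lty.
have g_pos' : (0 < P [set w | forall k : unit, (0 < g (xi 0 w))%R])%E.
  rewrite (_ : [set w | forall k, _] = [set w | (0 < g (xi 0 w))%R])//.
  by apply/seteqP; split => w gw //; exact: gw tt.
have [m [c [_ c0 jump]]] :=
  near_record_to_record xi_iid (fun=> mg) g_pos' (fun=> y).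
set S := (\sum_(0 <= n <oo) _)%E.
suff : (c%:E * S < +oo)%E.
  by rewrite !ltey; apply: contra_neq => ->; rewrite gt0_muley.
rewrite -nneseriesZl//; apply: le_lt_trans sum_lty.
apply: nneseries_le_bound => [n|N].
  by rewrite mule_ge0// lee_fin ltW.
pose r n := P (X @^-1` record (fun _ : unit => g) n).
apply: (@le_trans _ _ (\sum_(0 <= n < N) r (n + m)%N)%E).
  apply: lee_sum => n _; have := jump n setT.
  rewrite !setTI; apply.
  exact: (@measurableT _ (past n)).
have -> : (\sum_(0 <= n < N) r (n + m)%N = \sum_(m <= n < N + m) r n)%E.
  by rewrite -[in RHS](add0n m) big_addn addnK.
apply: (@le_trans _ _ (\sum_(0 <= n < N + m) r n)%E).
  by rewrite (@big_cat_nat _ _ _ m 0%N (N + m))/= ?leq_addl// leeDr// sume_ge0.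
exact: nneseries_lim_ge.
Qed.

End RecordSums.

(** * Records and exit times of the gap walk as events on trajectories *)

Lemma lt_first_time (R : realType) (A : set nat) (n : nat) :
  (n%:R%:E < first_time R A)%E <-> forall j, A j -> (n < j)%N.
Proof.
split=> [nA j Aj|nA].
  have : (first_time R A <= j%:R%:E)%E by apply: ereal_inf_lbound; exists j.
  by move=> /(lt_le_trans nA); rewrite lte_fin ltr_nat.
(* Times are integers, so the infimum is at least [n + 1], also when [A] is empty. *)
apply: (@lt_le_trans _ _ n.+1%:R%:E); first by rewrite lte_fin ltr_nat.
by apply/ereal_infP => _ [j Aj <-]; rewrite lee_fin ler_nat nA.
Qed.

(** With [k] first, [gap k] is a function of one increment; by linearity its partial sums are the
    gaps of the walk. *)
Definition gap (R : realType) (d : nat) (k : 'I_d.-1) (x : d.-tuple R) : R :=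
  gaps x k.

Section GapWalk.
Context {disp : measure_display} {T : measurableType disp} {R : realType}.
Variables (P : probability T R) (d : nat) (xi : nat -> {RV P >-> d.-tuple R}).

Lemma nth_tnth (x : d.-tuple R) i (id : (i < d)%N) : x`_i = tnth x (Ordinal id).
Proof. by rewrite (tnth_nth 0). Qed.

Let ltd (k : 'I_d.-1) : (k.+1 < d)%N.
Proof. by have := ltn_ord k; rewrite ltn_predRL. Qed.

Lemma measurable_gap k : measurable_fun setT (@gap R d k).
Proof.
rewrite (_ : @gap R d k = (fun x => tnth x (Ordinal (ltd k)) -
    tnth x (Ordinal (ltnW (ltd k))))).
  by apply: measurable_funB; exact: measurable_tnth.
by apply/funext => x; rewrite /gap /gaps -!nth_tnth.
Qed.

Lemma gap_walkE n w k : gap_walk xi n w k = psum (gap k) n (trajectory xi w).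
Proof.
rewrite /gap_walk /gaps (nth_tnth _ (ltd k)) (nth_tnth _ (ltnW (ltd k))).
rewrite !tnth_mktuple /psum -sumrB; apply: eq_bigr => i _.
by rewrite /gap /gaps (nth_tnth _ (ltd k)) (nth_tnth _ (ltnW (ltd k))).
Qed.

Lemma near_recordE (y : 'I_d.-1 -> R) n w : (0 < n)%N ->
  vlt (gap_max xi n.-1 w - gap_walk xi n w) y <->
  near_record (@gap R d) y n (trajectory xi w).
Proof.
move=> n0; split => [near k j jn|near k].
  have := near k; rewrite fctE -!gap_walkE; apply: le_lt_trans.
  rewrite lerD2r /gap_max.
  have jn' : (j < n.-1.+1)%N by rewrite prednK.
  exact: (le_bigmax _ (fun j : 'I_n.-1.+1 => gap_walk xi j w k) (Ordinal jn')).
(* The default value of the maximum must be bounded too; it is the gap at time 0, which precedes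
   [n]. *)
rewrite fctE ltrBlDr /gap_max; apply: bigmax_lt => [|j _].
  by rewrite -ltrBlDr !gap_walkE near.
rewrite -ltrBlDr !gap_walkE near//.
by rewrite (leq_trans (ltn_ord j))// prednK.
Qed.

Lemma lt_first_recordE n w :
  (n%:R%:E < first_record xi w)%E <-> no_record (@gap R d) n (trajectory xi w).
Proof.
have recE j : (0 < j)%N -> vlt (gap_max xi j.-1 w) (gap_walk xi j w) <->
    record (@gap R d) j (trajectory xi w).
  move=> j0; rewrite /record -near_recordE//.
  by split => rec k; have := rec k; rewrite !fctE subr_lt0.
split => [/lt_first_time n_lt j /andP[j0 jn] rec|no_rec].
  suff : (n < j)%N by rewrite ltnNge jn.
  by apply: n_lt; split => //; exact/recE.
apply/lt_first_time => j [j0 /recE rec]; rewrite ltnNge; apply/negP => jn.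
by apply: (no_rec j); [rewrite j0|exact: rec].
Qed.

(** Nonnegativity allows the exchange of sum and integral. The series on the right has an additional
    term at [n = 0], whence an inequality. *)
Lemma h_up_le (x : d.-tuple R) : iid xi ->
  (h_up xi x <= 1 + \sum_(0 <= n <oo) P (trajectory xi @^-1`
    (no_record (@gap R d) n `&` near_record (@gap R d) (gaps x) n)))%E.
Proof.
move=> xi_iid; rewrite /h_up leeD2l//.
pose B n := no_record (@gap R d) n `&` near_record (@gap R d) (gaps x) n.
have mB n : measurable (trajectory xi @^-1` B n).
  apply: (measurable_past_event xi_iid (n := n)).
  apply: (@measurableI _ (past n)).
    exact: (no_record_past measurable_gap n).
  exact: (near_record_past measurable_gap _ (leqnn n)).
(* The empty set at 0 accounts for the sum in [h_up] starting at 1; later events absorb the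
   condition on [first_record]. *)
pose C n := if n is 0%N then set0 else trajectory xi @^-1` B n.
have mC n : measurable (C n) by case: n => [|n]; [exact: measurable0|exact: mB].
rewrite (eq_integral (fun w => \sum_(0 <= n <oo) (\1_(C n) w)%:E)%E);
    last first.
  move=> w _; rewrite eseries_cond [LHS]eseries_mkcond.
  apply: eq_eseriesr => -[|n] _; first by rewrite andbF /= indic0.
  rewrite andbT !indicE.
  case: ifPn => [/lt_first_recordE nrec|].
    congr (_%:R%:E); congr nat_of_bool; apply/idP/idP; rewrite !inE /=.
      by move=> /(near_recordE _ _ (ltn0Sn n)).
    by move=> [_] /(near_recordE _ _ (ltn0Sn n)).
  move=> /negP nrec; rewrite memNset//= => -[no_rec _].
  exact/nrec/lt_first_recordE.
rewrite integral_nneseries//; last first.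
  by move=> n; apply/measurable_EFinP; exact: measurable_indic.
apply: lee_nneseries => [n _ _|n _]; first exact: integral_ge0.
rewrite integral_indic// setIT; apply: le_measure; rewrite ?inE//.
  exact: mB.
by case: n => [|n] w [].
Qed.

Lemma measurable_gap_walk n k :
  measurable_fun setT (fun w => gap_walk xi n w k).
Proof.
rewrite (_ : (fun _ => _) = fun w => \sum_(i < n) gap k (xi i w)).
  apply: measurable_sum => i; apply: (measurableT_comp (measurable_gap k)).
  exact: measurable_funPT.
by apply/funext => w; rewrite gap_walkE.
Qed.

Lemma weyl_gaps (x : d.-tuple R) : weyl R d x <-> forall k, 0 < gaps x k.
Proof.
split => [/(sortedP 0) sx k|x0].
  by rewrite subr_gt0 sx// size_tuple.
apply/(sortedP 0) => i; rewrite size_tuple => id.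
have id' : (i < d.-1)%N by rewrite ltn_predRL.
by rewrite -subr_gt0; exact: (x0 (Ordinal id')).
Qed.

(** Never exiting means that all gaps are positive at every time from 1 on, a countable
    intersection. *)
Lemma measurable_never_exits : measurable [set w | exit_time xi w = +oo%E].
Proof.
rewrite (_ : [set _ | _] =
  \bigcap_(n in [set n | (1 <= n)%N])
    [set w | forall k, 0 < gap_walk xi n w k]).
  apply: bigcap_measurableType => n _; apply: measurable_all_gt => k.
  exact: measurable_gap_walk.
apply/seteqP; split => w /=.
  move=> /ereal_inf_pinfty noexit n n1; apply/weyl_gaps; apply: contrapT => nW.
  by have := noexit n%:R%:E (ex_intro2 _ _ n (conj n1 nW) erefl).
move=> inW; apply/ereal_inf_pinfty => _ [n [n1 nW] <-].
by case: nW; apply/weyl_gaps => k; exact: inW.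
Qed.

End GapWalk.

(** * The three cases of the finiteness theorem *)

Theorem lemma1 (disp : measure_display) (T : measurableType disp)
    (R : realType) (P : probability T R) (d : nat) (d_ge2 : (2 <= d)%N)
    (xi : nat -> {RV P >-> d.-tuple R}) (xi_iid : iid xi)
    (up_pos : forall k, (0 < P [set w | (0 < gap_walk xi 1 w k)%R])%E)
    (down_pos : forall k, (0 < P [set w | (gap_walk xi 1 w k < 0)%R])%E)
    (cond :
      [\/ exists k, drifts_ninfty xi k,
          (forall k, drifts_pinfty xi k) /\
            (0 < P [set w | exit_time xi w = +oo%E])%E
        | exists eps : 'I_d.-1 -> R, (forall k, 0 < eps k) /\
            (0 < P [set w | vlt eps (gap_walk xi 1 w)])%E]) :
  forall x : d.-tuple R, weyl R d x -> (h_up xi x < +oo)%E.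
Proof.
move=> x _; apply: le_lt_trans (h_up_le x xi_iid) _.
apply: lte_add_pinfty; first exact: ltry.
have mgap k : measurable_fun setT (@gap R d k) by exact: measurable_gap.
have gap_walk1 w k : gap_walk xi 1 w k = gap k (xi 0%N w).
  by rewrite gap_walkE /psum big_ord1.
(* Common to cases (2) and (3): it suffices to find an event of positive probability on which the
   first increment raises every gap. *)
have all_up A : measurable A -> (0 < P A)%E ->
    A `<=` [set w | forall k, 0 < gap_walk xi 1 w k] ->
    (\sum_(0 <= n <oo) P (trajectory xi @^-1`
      (no_record (@gap R d) n `&` near_record (@gap R d) (gaps x) n)) < +oo)%E.
  move=> mA A0 Aup; apply: (sum_near_record_before_record_lty xi_iid) => //.
  apply: (lt_le_trans A0); apply: le_measure; rewrite ?inE//.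
    apply: measurable_all_gt => k; exact: (measurableT_comp (mgap k)).
  by move=> w /Aup up k; rewrite -gap_walk1; exact: up.
case: cond => [[k drift]|[_ stay]|[eps [eps0 jump]]].
- have up : (0 < P [set w | (0 < gap k (xi 0%N w))%R])%E.
    by have := up_pos k; under eq_set do rewrite gap_walk1.
  have drift' : {ae P, forall w,
      psum (gap k) n (trajectory xi w) @[n --> \oo] --> -oo}.
    apply: filterS drift => w; apply: cvg_trans; apply: near_eq_cvg.
    by apply: nearW => n; rewrite gap_walkE.
  have H := sum_near_record_lty xi_iid (gaps x k) (mgap k) up drift'.
  (* A near-record of all gaps is one of gap [k] alone, so the terms compare one by one. *)
  apply: (le_lt_trans _ H).
  apply: lee_nneseries => [n _ _|n _]; first exact: measure_ge0.
  apply: le_measure; rewrite ?inE.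
  + apply: (measurable_past_event xi_iid (n := n)).
    apply: (@measurableI _ (past n)); first exact: (no_record_past mgap n).
    exact: (near_record_past mgap _ (leqnn n)).
  + apply: (measurable_past_event xi_iid (n := n)).
    by apply: near_record_past.
  + by move=> w [_ near] _ j jn; exact: near.
- apply: all_up stay _; first exact: measurable_never_exits.
  (* Only time 1 matters here: leaving the chamber at that time would make the exit time finite. *)
  move=> w /ereal_inf_pinfty noexit; apply/weyl_gaps; apply: contrapT => nW.
  by have := noexit 1%:R%:E (ex_intro2 _ _ 1%N (conj isT nW) erefl).
- apply: all_up jump _.
    apply: measurable_all_gt => k; exact: measurable_gap_walk.
  by move=> w jump k; exact: lt_trans (eps0 k) (jump k).
Qed.
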